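(* The $n$-th Fibonacci polynomial $f_n(x)$, considered over $\mathbb{Z}$, is self-reciprocal if and only if $n\in\{3,5\}$.
   Context: The Fibonacci polynomials $f_n(x)\in\mathbb{Z}[x]$ are defined by $f_0(x)=0$, $f_1(x)=1$, and $f_n(x)=xf_{n-1}(x)+f_{n-2}(x)$ for $n\ge 2$. The reciprocal of a polynomial $f(x)$ of degree $d$ is $f^*(x)=x^d f(1/x)$. A polynomial $f$ is called self-reciprocal if $f^*=f$, i.e. if $f(x)=a_0+a_1x+\cdots+a_dx^d$ with $a_d\neq 0$, then $a_i=a_{d-i}$ for all $0\le i\le d$.
   Formalization: The case n = 1 is excluded: f_1(x) = 1 is a constant of degree 0 and equals its own reciprocal, so it is self-reciprocal although 1 is not in {3,5}; the equivalence is stated and proved for every other n, including n = 0. *)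

(* Defs.v *)
From mathcomp Require Import all_boot all_order all_algebra.
Set Implicit Arguments.
Unset Strict Implicit.
Unset Printing Implicit Defensive.
Import GRing.Theory.
Local Open Scope ring_scope.

Fixpoint fibpoly (n : nat) : {poly int} :=
  match n with
  | 0%N => 0
  | 1%N => 1
  | (n2.+1 as n1).+1 => 'X * fibpoly n1 + fibpoly n2
  end.

(* 'X^d p(1/'X) with d = (size p).-1 the degree of p, expanded term by term;
   see [horner_reciprocal]. *)
Definition reciprocal (R : nzRingType) (p : {poly R}) : {poly R} :=
  \sum_(i < size p) p`_i *: 'X^((size p).-1 - i).

(* The zero polynomial has no degree, hence no reciprocal; it is excluded
   explicitly because [(size 0).-1 = 0] would make [reciprocal 0 = 0]. *)
Definition self_reciprocal (R : nzRingType) (p : {poly R}) : Prop :=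
  p <> 0 /\ reciprocal p = p.

Lemma horner_reciprocal (R : comUnitRingType) (p : {poly R}) (x : R) :
  x \is a GRing.unit ->
  (reciprocal p).[x] = x ^+ (size p).-1 * p.[x^-1].
Proof.
move=> Ux; rewrite horner_sum horner_coef mulr_sumr; apply: eq_bigr => i _.
have le_id : (i <= (size p).-1)%N by rewrite -ltnS (ltn_predK (ltn_ord i)).
by rewrite hornerZ hornerXn exprVn mulrCA exprB.
Qed.

Lemma coef_reciprocal (R : nzRingType) (p : {poly R}) (i : nat) :
  (i <= (size p).-1)%N -> (reciprocal p)`_i = p`_((size p).-1 - i).
Proof.
move=> le_id; have [->|p_neq0] := eqVneq p 0.
  by rewrite /reciprocal size_poly0 big_ord0 !coef0.
have sz : (0 < size p)%N by rewrite size_poly_gt0.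
have lt_k : ((size p).-1 - i < size p)%N.
  by rewrite (leq_ltn_trans (leq_subr _ _)) // prednK.
rewrite coef_sum (bigD1 (Ordinal lt_k)) //= coefZ coefXn subKn // eqxx mulr1.
rewrite big1 ?addr0 // => j; rewrite -val_eqE /= => /eqP j_neq.
rewrite coefZ coefXn; case: eqP => [i_eq|_]; last by rewrite mulr0.
case: j_neq; rewrite i_eq subKn // -ltnS prednK //; exact: ltn_ord.
Qed.

(* Main.v *)
Require Import Defs.
From mathcomp Require Import all_boot all_order all_algebra.
From mathcomp Require Import zify.

(** For n = 2m+1 the coefficients of x^2 and of x^(n-3) in f_n are m(m+1)/2 and
    2m-1; they agree only if (m-1)(m-2) = 0.  For even n the constant term
    vanishes, while f_n is monic. *)

Import GRing.Theory.
Local Open Scope ring_scope.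

(** For odd n >= 3 the degree d = n - 1 is at least 2, so symmetry forces a_2 = a_(d-2); with a_0 =
    a_d, which rules out even n, this leaves only 3 and 5. The low coefficients come from
    [fibpoly_coef0] and [fibpoly_coef12], the high ones from [fibpoly_coef_top] and
    [fibpoly_coef_subtop]. Conversely, f_3 = x^2 + 1 and f_5 = x^4 + 3x^2 + 1 are visibly
    palindromic. *)

Lemma fibpolySS (n : nat) :
  fibpoly n.+2 = 'X * fibpoly n.+1 + fibpoly n.
Proof. by []. Qed.

Lemma coef0_fibpolySS (n : nat) : (fibpoly n.+2)`_0 = (fibpoly n)`_0.
Proof. by rewrite fibpolySS coefD coefXM add0r. Qed.

Lemma coefS_fibpolySS (n i : nat) :
  (fibpoly n.+2)`_i.+1 = (fibpoly n.+1)`_i + (fibpoly n)`_i.+1.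
Proof. by rewrite fibpolySS coefD coefXM. Qed.

Lemma fibpoly_coef_gt (n i : nat) : (n <= i)%N -> (fibpoly n)`_i = 0.
Proof.
elim/ltn_ind: n i => [[|[|n]]] IHn [|i] // le_ni; rewrite ?coef0 ?coef1 //.
by rewrite coefS_fibpolySS !IHn ?addr0 //; lia.
Qed.

Lemma fibpoly_coef_top (n : nat) : (fibpoly n.+1)`_n = 1.
Proof.
elim: n => [|n IHn]; first by rewrite coef1.
by rewrite coefS_fibpolySS IHn fibpoly_coef_gt ?addr0.
Qed.

Lemma size_fibpoly (n : nat) : size (fibpoly n) = n.
Proof.
case: n => [|n]; first exact: size_poly0.
apply/eqP; rewrite eqn_leq; apply/andP; split.
  by apply/leq_sizeP => i /fibpoly_coef_gt.
by rewrite ltnNge; apply/negP => /leq_sizeP/(_ n (leqnn n)); rewrite fibpoly_coef_top.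
Qed.

(** The index is two below the degree; each step of the recurrence adds the leading coefficient 1 of
    the polynomial two places earlier. *)
Lemma fibpoly_coef_subtop (n : nat) : (fibpoly n.+3)`_n = n.+1%:Z.
Proof.
elim: n => [|n IHn]; first by rewrite coef0_fibpolySS coef1.
by rewrite coefS_fibpolySS IHn fibpoly_coef_top; lia.
Qed.

Lemma fibpoly_coef0 (n : nat) : (fibpoly n)`_0 = (odd n)%:Z.
Proof.
elim/ltn_ind: n => [[|[|n]]] IHn; rewrite ?coef0 ?coef1 //.
by rewrite coef0_fibpolySS IHn //= negbK.
Qed.

(** The four values feed one another through the recurrence, hence the joint induction. The linear
    coefficients of the even-index polynomials sum to triangular numbers, by Pascal's rule. *)
Lemma fibpoly_coef12 (m : nat) :
  [/\ (fibpoly m.*2)`_1 = m%:Z, (fibpoly m.*2.+1)`_1 = 0,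
      (fibpoly m.*2)`_2 = 0 & (fibpoly m.*2.+1)`_2 = 'C(m.+1, 2)%:Z].
Proof.
elim: m => [|m [e1 o1 e2 o2]]; first by rewrite !coef0 !coef1.
have e1' : (fibpoly m.+1.*2)`_1 = m.+1%:Z.
  by rewrite doubleS coefS_fibpolySS e1 fibpoly_coef0 /= odd_double; lia.
have o1' : (fibpoly m.+1.*2.+1)`_1 = 0.
  by rewrite doubleS coefS_fibpolySS fibpoly_coef0 /= negbK odd_double o1.
split=> //; first by rewrite doubleS coefS_fibpolySS o1 e2.
by rewrite [in LHS]doubleS coefS_fibpolySS -doubleS e1' o2 [in RHS]binS bin1; lia.
Qed.

Lemma self_reciprocal_coef (R : nzRingType) (p : {poly R}) (i : nat) :
  self_reciprocal p -> (i <= (size p).-1)%N -> p`_i = p`_((size p).-1 - i).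
Proof. by move=> [_ recip_p] /coef_reciprocal <-; rewrite recip_p. Qed.

Lemma coef_self_reciprocal (R : nzRingType) (p : {poly R}) :
  p != 0 -> (forall i, (i < size p)%N -> p`_i = p`_((size p).-1 - i)) ->
  self_reciprocal p.
Proof.
move=> p_neq0 sym_p; split; first exact/eqP.
(* Summing in reverse order puts the exponents back in place, so only the coefficients remain to be
   compared. *)
rewrite -[RHS]coefK poly_def /reciprocal (reindex_inj rev_ord_inj) /=.
apply: eq_bigr => i _; have lt_ip := ltn_ord i.
by rewrite (sym_p i) // subnS predn_sub subKn // -ltnS (ltn_predK lt_ip).
Qed.

Theorem theorem2p3 (n : nat) (n_neq1 : n <> 1%N) :
  self_reciprocal (fibpoly n) <-> (n = 3%N \/ n = 5%N).
Proof.
split=> [sr_n | n35].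
  have n_gt0 : (0 < n)%N by rewrite -[n]size_fibpoly size_poly_gt0; apply/eqP; case: sr_n.
  have odd_n : odd n.
    have := self_reciprocal_coef _ _ 0 sr_n (leq0n _).
    rewrite size_fibpoly subn0 fibpoly_coef0 -[in RHS](prednK n_gt0).
    by rewrite fibpoly_coef_top; case: (odd n).
  (* Here [n_neq1] discards f_1 = 1, which is itself a palindrome. *)
  have [m n_eq] : exists m, n = m.+1.*2.+1 by exists n./2.-1; lia.
  have := self_reciprocal_coef _ _ 2 sr_n; rewrite size_fibpoly n_eq => /(_ isT).
  have [_ _ _ ->] := fibpoly_coef12 m.+1.
  rewrite doubleS /= !subSS subn0 fibpoly_coef_subtop => -[].
  (* Doubling clears the binomial: 2(2m + 1) = (m + 2)(m + 1), that is m(m - 1) = 0. *)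
  have := bin_ffact m.+2 2; rewrite !ffactnS ffactn0 /= => binE eq_coef.
  rewrite eq_coef (_ : 2`! = 2)%N // in binE.
  by nia.
apply: coef_self_reciprocal; first by rewrite -size_poly_gt0 size_fibpoly; case: n35 => ->.
rewrite size_fibpoly; case: n35 => -> [|[|[|[|[|i]]]]] //= _;
  by rewrite ?(subn0, subSS, coefD, coefXM, coef0, coef1).
Qed.
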